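(* For any integer $\ell\geq 6$ there exists a graph $G$ with an edge $e$ such that $\gamma_g'(G)=\ell$ and $\gamma_g'(G-e)=\ell-2$.
   Context: Graphs are finite, simple and undirected. A vertex dominates itself and all its neighbors. The domination game on a graph $G$ is played by two players, Dominator and Staller, who alternately choose a vertex of $G$ such that each chosen vertex dominates at least one vertex that was not dominated by the previously chosen vertices. The game ends when all vertices of $G$ are dominated. Dominator wants the total number of chosen vertices to be as small as possible, Staller wants it to be as large as possible. Assuming both play optimally, $\gamma_g'(G)$ (the Staller-start game domination number) is the total number of vertices chosen when Staller moves first. $G-e$ denotes the graph obtained from $G$ by removing the edge $e$ (keeping all vertices). *)

(* Defs.v *)
From HB Require Import structures.
From mathcomp Require Import all_boot.

Set Implicit Arguments.
Unset Strict Implicit.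
Unset Printing Implicit Defensive.

Record sgraph := SGraph {
  vertex :> finType;
  adj : rel vertex;
  adj_sym : symmetric adj;
  adj_irrefl : irreflexive adj }.

Section EdgeDeletion.
Variables (G : sgraph) (x y : G).

Definition del_edge_adj : rel G :=
  fun u v => adj u v && ([set u; v] != [set x; y]).

Lemma del_edge_sym : symmetric del_edge_adj.
Proof. by move=> u v; rewrite /del_edge_adj adj_sym setUC. Qed.

Lemma del_edge_irrefl : irreflexive del_edge_adj.
Proof. by move=> u; rewrite /del_edge_adj adj_irrefl. Qed.

Definition del_edge : sgraph := SGraph del_edge_sym del_edge_irrefl.

End EdgeDeletion.

Inductive player := Dominator | Staller.

Section DominationGame.
Variable G : sgraph.
Implicit Types (D : {set G}) (v : G).

Definition closed_nbhd v : {set G} := [set u | (u == v) || adj v u].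

(* A position is given by the set D of vertices dominated so far, together
   with the player to move. *)
Definition legal D v := ~~ (closed_nbhd v \subset D).

(* Number of moves still made under optimal play.  The argument n is fuel:
   a legal move strictly enlarges D, so n = #|~: D| is enough.  With fuel n
   the result is at most n, so the default value n of the minimum below never
   undercuts the minimum over the legal moves; these exist when D is not the
   whole vertex set.  Lemmas moves_left_staller and moves_left_dominator are
   the resulting fuel-free minimax equations. *)
Fixpoint moves_left_rec n p D : nat :=
  if n is n'.+1 then
    if D == setT then 0 else
    match p with
    | Dominator =>
        (\big[minn/n']_(v | legal D v)
           moves_left_rec n' Staller (D :|: closed_nbhd v)).+1
    | Staller =>
        (\max_(v | legal D v)
           moves_left_rec n' Dominator (D :|: closed_nbhd v)).+1
    end
  else 0.

Definition moves_left p D := moves_left_rec #|~: D| p D.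

Definition staller_start_game_number := moves_left Staller set0.

Lemma legal_exists D : D != setT -> exists v, legal D v.
Proof.
rewrite -subTset => /subsetPn[v _ vD]; exists v.
by apply/subsetPn; exists v; rewrite // inE eqxx.
Qed.

Lemma legal_card D v : legal D v -> #|~: (D :|: closed_nbhd v)| < #|~: D|.
Proof.
move=> /subsetPn[u uv uD]; apply: proper_card; rewrite setCU.
by apply/properP; split; [exact: subsetIl | exists u; rewrite !inE ?negb_and;
  rewrite inE in uv; rewrite ?uv ?orbT ?uD].
Qed.

Lemma undominated0 D : (#|~: D| == 0) = (D == setT).
Proof. by rewrite cards_eq0 -setCT (inj_eq (@setC_inj G)). Qed.

Lemma moves_left_rec_le n p D : moves_left_rec n p D <= n.
Proof.
elim: n p D => [|n IHn] p D //=; case: eqP => // _; case: p; rewrite ltnS.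
  by elim/big_ind: _ => // a b an _; rewrite geq_min an.
by apply/bigmax_leqP => v _.
Qed.

Lemma bigmin_default (P : pred G) (F : G -> nat) a b w :
  P w -> (forall v, P v -> F v <= a) -> (forall v, P v -> F v <= b) ->
  \big[minn/a]_(v | P v) F v = \big[minn/b]_(v | P v) F v.
Proof.
have aux c d : P w -> (forall v, P v -> F v <= d) ->
    \big[minn/c]_(v | P v) F v <= \big[minn/d]_(v | P v) F v.
  have le_c v : P v -> \big[minn/c]_(v | P v) F v <= F v.
    move=> Pv; rewrite -big_filter.
    have : v \in [seq i <- index_enum G | P i].
      by rewrite mem_filter Pv mem_index_enum.
    elim: [seq _ <- _ | _] => // u s IHs; rewrite inE big_cons geq_min.
    by case/orP=> [/eqP->|/IHs->]; rewrite ?leqnn ?orbT.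
  move=> Pw Fd; apply: (big_ind (leq _)) => [||v /le_c //].
    exact: leq_trans (le_c w Pw) (Fd w Pw).
  by move=> s t hs ht; rewrite leq_min hs ht.
by move=> Pw Fa Fb; apply/eqP; rewrite eqn_leq !aux.
Qed.

Lemma moves_left_rec_fuel n p D :
  #|~: D| <= n -> moves_left_rec n p D = moves_left p D.
Proof.
rewrite /moves_left; move: {2}#|~: D| (leqnn #|~: D|) => m.
have [k] := ubnP n.
suff main : forall k n m p D, n < k -> #|~: D| <= n -> #|~: D| <= m ->
    moves_left_rec n p D = moves_left_rec m p D.
  by move=> nk _ Dn; apply: (main k).
elim=> {k n m p D} // k IHk [|n] [|m] p D nk Dn Dm //=.
- by rewrite leqn0 undominated0 in Dn; rewrite Dn.
- by rewrite leqn0 undominated0 in Dm; rewrite Dm.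
have step q v : legal D v -> moves_left_rec n q (D :|: closed_nbhd v)
    = moves_left_rec m q (D :|: closed_nbhd v).
  move=> /legal_card lt; apply: IHk => //.
    by rewrite -ltnS (leq_trans lt).
  by rewrite -ltnS (leq_trans lt).
case: eqP => // /eqP /legal_exists[w Dw]; case: p; congr _.+1; last first.
  by apply: eq_bigr => v /step.
rewrite (eq_bigr _ (fun v Dv => step Staller v Dv)).
apply: (bigmin_default Dw) => v Dv; last exact: moves_left_rec_le.
by rewrite -step // moves_left_rec_le.
Qed.

Lemma moves_left_end p : moves_left p setT = 0.
Proof. by rewrite /moves_left setCT cards0. Qed.

Lemma moves_left_staller D : D != setT ->
  moves_left Staller D =
    (\max_(v | legal D v) moves_left Dominator (D :|: closed_nbhd v)).+1.
Proof.
move=> DT; rewrite -(moves_left_rec_fuel _ (leqnSn _)) /= (negbTE DT).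
congr _.+1; apply: eq_bigr => v /legal_card lt.
by rewrite moves_left_rec_fuel // ltnW.
Qed.

Lemma moves_left_dominator D : D != setT ->
  moves_left Dominator D =
    (\big[minn/#|G|]_(v | legal D v)
       moves_left Staller (D :|: closed_nbhd v)).+1.
Proof.
move=> DT; have [w Dw] := legal_exists DT.
rewrite -(moves_left_rec_fuel _ (leqnSn _)) /= (negbTE DT); congr _.+1.
have step v : legal D v -> moves_left_rec #|~: D| Staller (D :|: closed_nbhd v)
    = moves_left Staller (D :|: closed_nbhd v).
  by move=> /legal_card lt; rewrite moves_left_rec_fuel // ltnW.
rewrite (eq_bigr _ step); apply: (bigmin_default Dw) => v Dv.
  by rewrite -step // moves_left_rec_le.
exact: leq_trans (moves_left_rec_le _ _ _) (max_card _).
Qed.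

End DominationGame.

(* Main.v *)
(* Two new isolated vertices raise the Staller-start number by exactly 2: each
   player can answer a move on one of them by the other.  This reduces the
   theorem to l = 6 and l = 7, where exhaustive search settles a concrete graph.
   It is a star K_{1,4} with a leaf y, a graph X in which moving first costs
   Dominator one move, and the edge e = xy for some x in X.  Without e,
   Dominator ends play in the star in two moves and Staller has to open X.
   With e, if Staller takes a leaf of the star other than y and Dominator the
   centre, Staller can then waste a move on y, which newly dominates only x,
   and it is Dominator who has to open X. *)
Require Import Defs.
From HB Require Import structures.
From mathcomp Require Import all_boot.

Set Implicit Arguments.
Unset Strict Implicit.
Unset Printing Implicit Defensive.

(** * Optimal moves for either player *)

Section OptimalMoves.
Variable G : sgraph.
Implicit Types (D : {set G}) (v : G).

Lemma moves_left_gt0 p D : D != setT -> 0 < moves_left p D.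
Proof.
by case: p => DT; rewrite ?moves_left_dominator ?moves_left_staller.
Qed.

Lemma legal_neqT D v : legal D v -> D != setT.
Proof. by apply: contraNneq => ->; exact: subsetT. Qed.

Lemma staller_move D v : legal D v ->
  moves_left Dominator (D :|: closed_nbhd v) < moves_left Staller D.
Proof.
move=> Dv; rewrite moves_left_staller ?(legal_neqT Dv) // ltnS.
exact: (bigmax_sup v).
Qed.

Lemma staller_best D : D != setT -> exists2 v, legal D v &
  moves_left Staller D = (moves_left Dominator (D :|: closed_nbhd v)).+1.
Proof.
move=> DT; have [w Dw] := legal_exists DT; rewrite moves_left_staller //.
by rewrite (bigmax_eq_arg w) //; case: arg_maxnP => // v Dv _; exists v.
Qed.

Lemma dominator_bestP D : D != setT -> exists v, [/\ legal D v,
    moves_left Dominator D = (moves_left Staller (D :|: closed_nbhd v)).+1 &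
    forall w, legal D w -> moves_left Staller (D :|: closed_nbhd v)
                        <= moves_left Staller (D :|: closed_nbhd w)].
Proof.
move=> DT; have [w Dw] := legal_exists DT; rewrite moves_left_dominator //.
pose F v := moves_left Staller (D :|: closed_nbhd v).
have [v Dv Fmin] := arg_minnP F Dw; exists v; split=> //.
(* The minimum has default value [#|G|]; this bound shows that the default never undercuts the value
   of the best move. *)
have Fle u : F u <= #|G| := leq_trans (moves_left_rec_le _ _ _) (max_card _).
congr _.+1; apply/eqP; rewrite eqn_leq; apply/andP; split; last first.
  elim/big_ind: _ => [|a b av bv|u /Fmin //]; first exact: Fle.
  by rewrite leq_min av bv.
elim: index_enum (mem_index_enum v) => // u s IHs; rewrite inE big_cons.
case/predU1P=> [<-|/IHs le_v]; first by rewrite Dv geq_minl.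
by case: ifP => // _; rewrite geq_min le_v orbT.
Qed.

Lemma dominator_best D : D != setT -> exists2 v, legal D v &
  moves_left Dominator D = (moves_left Staller (D :|: closed_nbhd v)).+1.
Proof. by case/dominator_bestP => v [] *; exists v. Qed.

Lemma dominator_move D v : legal D v ->
  moves_left Dominator D <= (moves_left Staller (D :|: closed_nbhd v)).+1.
Proof.
move=> Dv; have [w [_ -> wmin]] := dominator_bestP (legal_neqT Dv).
by rewrite ltnS wmin.
Qed.

End OptimalMoves.

(** * Adding two isolated vertices *)

Section TwoIsolatedVertices.
Variables (T : finType) (e : rel T) (e_sym : symmetric e).
Variables (e_irrefl : irreflexive e).
Variables (e2 : rel (T + bool)%type) (e2_sym : symmetric e2).
Variables (e2_irrefl : irreflexive e2).
Hypothesis e2_inl : forall u v, e2 (inl u) (inl v) = e u v.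
Hypothesis e2_inr : forall b w, e2 (inr b) w = false.

Let G := SGraph e_sym e_irrefl.
Let H := SGraph e2_sym e2_irrefl.
Implicit Types (A : {set G}) (B : {set bool}) (p : player) (b : bool).

(** By [e2_inr] and symmetry the vertices [inr b] are isolated, so no closed neighbourhood meets
    both summands and each move changes only one of [A] and [B]. *)
Let pos A B : {set H} :=
  [set w : H | match w with inl u => u \in A | inr b => b \in B end].

Let nbhd_inl (v : G) : closed_nbhd (inl v : H) = pos (closed_nbhd v) set0.
Proof.
by apply/setP=> -[u|b]; rewrite !inE /= ?e2_inl // e2_sym e2_inr.
Qed.

Let nbhd_inr b : closed_nbhd (inr b : H) = pos set0 [set b].
Proof. by apply/setP=> -[u|b']; rewrite !inE /= e2_inr ?orbF. Qed.

Let posU A B A' B' : pos A B :|: pos A' B' = pos (A :|: A') (B :|: B').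
Proof. by apply/setP=> -[u|b]; rewrite !inE. Qed.

Let sub_pos A B A' B' :
  (pos A B \subset pos A' B') = (A \subset A') && (B \subset B').
Proof.
apply/subsetP/andP => [AB|[/subsetP sA /subsetP sB]].
  by split; apply/subsetP => z zA; [have := AB (inl z)|have := AB (inr z)];
     rewrite !inE; apply.
by move=> [u|b]; rewrite !inE; [exact: sA|exact: sB].
Qed.

Let pos_eqT A B : (pos A B == setT) = (A == setT) && (B == setT).
Proof.
have posT : pos setT setT = setT by apply/setP=> -[u|b]; rewrite !inE.
by rewrite -!subTset -posT sub_pos.
Qed.

Let legal_inl A B (v : G) : legal (pos A B) (inl v : H) = legal A v.
Proof. by rewrite /legal nbhd_inl sub_pos sub0set andbT. Qed.

Let legal_inr A B b : legal (pos A B) (inr b : H) = (b \notin B).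
Proof. by rewrite /legal nbhd_inr sub_pos sub0set sub1set. Qed.

Let after_inl A B (v : G) :
  pos A B :|: closed_nbhd (inl v : H) = pos (A :|: closed_nbhd v) B.
Proof. by rewrite nbhd_inl posU setU0. Qed.

Let after_inr A B b : pos A B :|: closed_nbhd (inr b : H) = pos A (b |: B).
Proof. by rewrite nbhd_inr posU setU0 setUC. Qed.

Let moves_left_both p A : moves_left p (pos A setT) = moves_left p A.
Proof.
have [k] := ubnP #|~: A|; elim: k p A => // k IHk p A; rewrite ltnS => Ak.
have IH q v : legal A v -> moves_left q (pos (A :|: closed_nbhd v) setT)
    = moves_left q (A :|: closed_nbhd v).
  by move=> /legal_card lt; apply: IHk; exact: leq_trans lt Ak.
have [/eqP AT|AT] := boolP (A == setT).
  have /eqP-> : pos A setT == setT by rewrite pos_eqT AT !eqxx.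
  by rewrite AT !moves_left_end.
have PT : pos A setT != setT by rewrite pos_eqT negb_and AT.
case: p; apply/eqP; rewrite eqn_leq; apply/andP; split.
- have [v Av ->] := dominator_best AT; rewrite -IH // -after_inl.
  by apply: dominator_move; rewrite legal_inl.
- have [[v|b]] := dominator_best PT; last by rewrite legal_inr inE.
  by rewrite legal_inl after_inl => Av ->; rewrite IH // dominator_move.
- have [[v|b]] := staller_best PT; last by rewrite legal_inr inE.
  by rewrite legal_inl after_inl => Av ->; rewrite IH // staller_move.
- have [v Av ->] := staller_best AT; rewrite -IH // -after_inl.
  by apply: staller_move; rewrite legal_inl.
Qed.

Let setU1_negb b : ~~ b |: [set b] = [set: bool].
Proof. by apply/setP=> c; rewrite !inE; case: b; case: c. Qed.

(** Dominator answers on the remaining isolated vertex [~~ b], which hands the turn back at [A]. *)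
Let dominator_one A b :
  moves_left Dominator (pos A [set b]) <= (moves_left Staller A).+1.
Proof.
rewrite -(moves_left_both Staller) -(setU1_negb b) -after_inr.
by apply: dominator_move; rewrite legal_inr inE; case: b.
Qed.

Let staller_one A b :
  moves_left Dominator A < moves_left Staller (pos A [set b]).
Proof.
rewrite -(moves_left_both Dominator) -(setU1_negb b) -after_inr.
by apply: staller_move; rewrite legal_inr inE; case: b.
Qed.

(** A best move inside [G] is copied, by induction on the undominated part of [G]. Opening on an
    isolated vertex gains nothing: the opponent takes the other one, and the same player is to move
    at [A] after two extra moves. *)
Let moves_left_none p A : moves_left p (pos A set0) = (moves_left p A).+2.
Proof.
have [k] := ubnP #|~: A|; elim: k p A => // k IHk p A; rewrite ltnS => Ak.
have IH q v : legal A v -> moves_left q (pos (A :|: closed_nbhd v) set0)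
    = (moves_left q (A :|: closed_nbhd v)).+2.
  by move=> /legal_card lt; apply: IHk; exact: leq_trans lt Ak.
have B0T : (set0 == setT :> {set bool}) = false.
  by apply/eqP=> /setP/(_ true); rewrite !inE.
have B1T b : ([set b] == setT) = false.
  by apply/eqP=> /setP/(_ (~~ b)); rewrite !inE; case: b.
have PT : pos A set0 != setT by rewrite pos_eqT B0T andbF.
have P1T b : pos A [set b] != setT by rewrite pos_eqT B1T andbF.
have free b : legal (pos A set0) (inr b : H) by rewrite legal_inr inE.
case: p; apply/eqP; rewrite eqn_leq; apply/andP; split.
(* When [A] is full there is no move of [G] to copy; exactly the two isolated vertices remain to be
   played. *)
- have [/eqP AT|AT] := boolP (A == setT); last first.
    have [v Av ->] := dominator_best AT; rewrite -IH // -after_inl.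
    by apply: dominator_move; rewrite legal_inl.
  apply: leq_trans (dominator_move (free true)) _.
  rewrite after_inr setU0 AT moves_left_end !ltnS -AT.
  have [[v|b]] := staller_best (P1T true).
    by rewrite legal_inl => /legal_neqT; rewrite AT eqxx.
  rewrite legal_inr inE after_inr => bt ->.
  have -> : b |: [set true] = setT.
    by move: bt; case: b => // _; exact: (setU1_negb true).
  by rewrite moves_left_both AT moves_left_end.
- have [[v|b]] := dominator_best PT.
    by rewrite legal_inl after_inl => Av ->; rewrite IH // !ltnS dominator_move.
  (* Staller's reply on the other isolated vertex. *)
  by rewrite after_inr setU0 => _ ->; rewrite ltnS staller_one.
- have [[v|b]] := staller_best PT.
    by rewrite legal_inl after_inl => Av ->; rewrite IH // !ltnS staller_move.
  by rewrite after_inr setU0 => _ ->; rewrite ltnS dominator_one.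
- have [/eqP AT|AT] := boolP (A == setT).
    apply: leq_trans (staller_move (free true)).
    by rewrite after_inr setU0 {1}AT moves_left_end ltnS moves_left_gt0.
  have [v Av ->] := staller_best AT; rewrite -IH // -after_inl.
  by apply: staller_move; rewrite legal_inl.
Qed.

Lemma staller_start_add2 :
  staller_start_game_number H = (staller_start_game_number G).+2.
Proof.
have pos0 : pos set0 set0 = set0 by apply/setP=> -[u|b]; rewrite !inE.
by rewrite /staller_start_game_number -pos0 moves_left_none.
Qed.

End TwoIsolatedVertices.

(** * Raising the target number by two *)

Lemma set2_eq (T : finType) (u v x y : T) :
  ([set u; v] == [set x; y]) =
  (u == x) && (v == y) || (u == y) && (v == x).
Proof.
apply/eqP/orP => [/setP uv|[]/andP[/eqP-> /eqP->] //]; last by rewrite setUC.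
move: (uv u) (uv v) (uv x) (uv y); rewrite !inE !eqxx ?orbT ?orTb.
rewrite (eq_sym x u) (eq_sym x v) (eq_sym y u) (eq_sym y v).
by case: (u == x); case: (u == y); case: (v == x); case: (v == y); auto.
Qed.

Definition drops_by_two l := exists (G : sgraph) (x y : G),
  adj x y /\
  staller_start_game_number G = l /\
  staller_start_game_number (del_edge x y) = l - 2.

Lemma drops_by_two_add2 l : 2 <= l -> drops_by_two l -> drops_by_two l.+2.
Proof.
move=> l2 [[T e e_sym e_irr] [x [y [xy [Gl Gl2]]]]].
pose e2 (p q : T + bool) : bool :=
  match p, q with inl u, inl v => e u v | _, _ => false end.
have e2_sym : symmetric e2 by move=> [u|b] [v|c] //=; exact: e_sym.
have e2_irr : irreflexive e2 by move=> [u|b] //=; exact: e_irr.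
exists (SGraph e2_sym e2_irr), (inl x), (inl y); split=> //; split.
  by rewrite (staller_start_add2 e_sym e_irr) ?Gl.
rewrite (staller_start_add2 (@del_edge_sym _ x y) (@del_edge_irrefl _ x y)).
(* Subtraction is truncated: [2 <= l] gives [l.+2 - 2 = (l - 2).+2]. *)
- by rewrite -[SGraph _ _]/(del_edge x y) Gl2 -!subSn ?leqW.
- by move=> u v; rewrite /del_edge_adj !set2_eq.
- by move=> b w; rewrite /del_edge_adj.
Qed.

(** * Exhaustive search on bit sequences *)

(* A position is a bit sequence marking the dominated vertices, and [rows]
   lists the closed neighbourhoods.  The result tells whether at least [m] more
   moves are made. *)
Fixpoint lasts (rows : seq bitseq) (m : nat) (p : player) (s : bitseq) : bool :=
  if m isn't m'.+1 then true else
  if all id s then false else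
  if m' == 0 then true else
  match p with
  | Staller => has (fun r => let s' := [seq b.1 || b.2 | b <- zip s r] in
      (s' != s) && lasts rows m' Dominator s') rows
  | Dominator => all (fun r => let s' := [seq b.1 || b.2 | b <- zip s r] in
      (s' == s) || lasts rows m' Staller s') rows
  end.

Definition closed_rows n (a : rel nat) : seq bitseq :=
  [seq [seq (u == v) || a v u | u <- iota 0 n] | v <- iota 0 n].

(** Two threshold queries pin the value down, and neither searches deeper than [l.+1] moves. *)
Definition game_number_is n (a : rel nat) l : bool :=
  let rows := closed_rows n a in
  lasts rows l Staller (nseq n false) &&
  ~~ lasts rows l.+1 Staller (nseq n false).

Section Search.
Variables (n : nat) (e : rel 'I_n) (e_sym : symmetric e).
Variables (e_irrefl : irreflexive e) (a : rel nat).
Hypothesis eE : forall u v : 'I_n, e u v = a u v.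

Let G := SGraph e_sym e_irrefl.
Let dom (s : bitseq) : {set G} := [set u : 'I_n | nth false s u].
Let row v : bitseq := [seq (u == v) || a v u | u <- iota 0 n].
Let join (s r : bitseq) : bitseq := [seq b.1 || b.2 | b <- zip s r].

Let size_join s v : size s = n -> size (join s (row v)) = n.
Proof. by move=> sn; rewrite size_map size_zip size_map size_iota sn minnn. Qed.

Let dom_join s (v : 'I_n) : size s = n ->
  dom (join s (row v)) = dom s :|: closed_nbhd (v : G).
Proof.
move=> sn; apply/setP=> u; rewrite !inE.
rewrite (nth_map (false, false)) ?size_zip ?size_map ?size_iota ?sn ?minnn //.
rewrite nth_zip ?size_map ?size_iota ?sn //=.
by rewrite (nth_map 0) ?size_iota // nth_iota // add0n -val_eqE /= eE.
Qed.

Let dom_inj s t : size s = n -> size t = n -> dom s = dom t -> s = t.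
Proof.
move=> sn tn /setP st; apply: (@eq_from_nth _ false); first by rewrite sn tn.
by move=> i; rewrite sn => lt_in; have := st (Ordinal lt_in); rewrite !inE.
Qed.

Let dom_T s : size s = n -> (dom s == setT) = all id s.
Proof.
move=> sn; apply/eqP/(all_nthP false) => [/setP sT i|sT].
  by rewrite sn => lt_in; have := sT (Ordinal lt_in); rewrite !inE.
by apply/setP=> u; rewrite !inE sT ?sn.
Qed.

(** Sequences of length [n] represent sets faithfully, so comparing [s'] with [s] in [lasts] tests
    legality. *)
Let legal_row s (v : 'I_n) : size s = n ->
  legal (dom s) (v : G) = (join s (row v) != s).
Proof.
move=> sn; rewrite /legal; congr (~~ _); apply/idP/eqP => [/setUidPl sv|js].
  by apply: dom_inj; rewrite ?size_join // dom_join.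
by apply/setUidPl; rewrite -dom_join // js.
Qed.

(** A threshold turns minimax into quantifiers: Staller needs one legal move that keeps enough
    moves, while for Dominator every legal move must. *)
Lemma lastsE m p s : size s = n ->
  lasts (closed_rows n a) m p s = (m <= moves_left p (dom s)).
Proof.
elim: m p s => // m IHm p s sn; rewrite [LHS]/= -dom_T //.
have [->|sT] := eqVneq; first by rewrite moves_left_end.
(* The shortcut of [lasts] when one move is required: an undominated vertex already forces it. *)
case: eqP => [->|_]; first by rewrite moves_left_gt0.
have step q (v : 'I_n) : lasts (closed_rows n a) m q (join s (row v))
    = (m <= moves_left q (dom s :|: closed_nbhd (v : G))).
  by rewrite IHm ?size_join // dom_join.
case: p.
  rewrite all_map; apply/allP/idP => [ok|lt v].
    have [v sv ->] := dominator_best sT; rewrite ltnS -step.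
    have /ok/= : val v \in iota 0 n by rewrite mem_iota ltn_ord.
    by rewrite (negbTE (_ : join s (row v) != s)) // -legal_row.
  rewrite mem_iota => /andP[_ lt_vn] /=; set v' := Ordinal lt_vn.
  have [//|sv] := eqVneq; have := step Staller v'; rewrite /= => ->.
  rewrite -ltnS; apply: leq_trans lt _; apply: dominator_move.
  by rewrite (legal_row v').
rewrite has_map; apply/hasP/idP => [[v]|lt].
  rewrite mem_iota => /andP[_ lt_vn] /=; set v' := Ordinal lt_vn.
  case/andP=> sv; have := step Dominator v'; rewrite /= => -> le_m.
  by apply: leq_ltn_trans le_m _; apply: staller_move; rewrite (legal_row v').
have [v sv eq_v] := staller_best sT.
exists (val v); first by rewrite mem_iota ltn_ord.
by rewrite /= -/(join s (row v)) -legal_row // sv step -ltnS -eq_v.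
Qed.

Lemma game_numberP l :
  game_number_is n a l -> staller_start_game_number G = l.
Proof.
have dom0 : dom (nseq n false) = set0.
  by apply/setP=> u; rewrite !inE nth_nseq if_same.
rewrite /game_number_is !lastsE ?size_nseq // dom0 -ltnNge ltnS => le_l.
by apply/eqP; rewrite eqn_leq andbC.
Qed.

End Search.

(** * The two concrete graphs *)

Section EdgeList.
Variables (n : nat) (E : seq (nat * nat)).

Definition list_adj : rel nat :=
  fun u v => (u != v) && (((u, v) \in E) || ((v, u) \in E)).

Lemma list_adj_sym : symmetric (fun u v : 'I_n => list_adj u v).
Proof. by move=> u v; rewrite /list_adj eq_sym orbC. Qed.

Lemma list_adj_irrefl : irreflexive (fun u v : 'I_n => list_adj u v).
Proof. by move=> u; rewrite /list_adj eqxx. Qed.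

Definition list_graph := SGraph list_adj_sym list_adj_irrefl.

Definition list_del_adj (x y : nat) : rel nat := fun u v =>
  list_adj u v && ~~ ((u == x) && (v == y) || (u == y) && (v == x)).

End EdgeList.

(** For concrete data the three hypotheses are closed booleans, settled by computation. *)
Lemma list_graph_example n E (x y : 'I_n) l :
    list_adj E x y -> game_number_is n (list_adj E) l ->
    game_number_is n (list_del_adj E x y) (l - 2) ->
  drops_by_two l.
Proof.
move=> xy Gl Gl2; exists (list_graph n E), x, y; split=> //; split.
  exact: game_numberP Gl.
apply: game_numberP Gl2 => u v /=.
by rewrite /del_edge_adj set2_eq.
Qed.

(* X is a hexagon, with game numbers 3 (Dominator-start) and 2
   (Staller-start). *)
Definition edges6 : seq (nat * nat) :=
  [:: (0,1); (1,2); (2,3); (3,4); (4,5); (5,0);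
      (6,7); (6,8); (6,9); (6,10); (0,7)].

(* X is a nine-vertex graph found by computer search, with game numbers 4
   (Dominator-start) and 3 (Staller-start). *)
Definition edges7 : seq (nat * nat) :=
  [:: (0,1); (1,2); (2,3); (3,4); (4,5); (5,6); (6,7); (7,0);
      (0,3); (2,7); (3,6); (0,8); (4,8); (6,8);
      (9,10); (9,11); (9,12); (9,13); (3,10)].

Lemma drops_by_two_6 : drops_by_two 6.
Proof.
(* The star has centre 6, and [e] joins its leaf 7 to vertex 0 of the hexagon. *)
exact: (@list_graph_example 11 edges6 (@Ordinal 11 0 isT) (@Ordinal 11 7 isT)).
Qed.

Lemma drops_by_two_7 : drops_by_two 7.
Proof.
(* The star has centre 9, and [e] joins its leaf 10 to vertex 3 of X. *)
exact: (@list_graph_example 14 edges7 (@Ordinal 14 3 isT) (@Ordinal 14 10 isT)).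
Qed.

Theorem proposition2p7 (l : nat) (hl : 6 <= l) :
  exists (G : sgraph) (x y : G),
    adj x y /\
    staller_start_game_number G = l /\
    staller_start_game_number (del_edge x y) = l - 2.
Proof.
(* Strong induction on [l - 6] in steps of two, hence the two base cases. *)
rewrite -/(drops_by_two l) -(subnKC hl); elim/ltn_ind: (l - 6) => -[|[|k]] IHk.
- exact: drops_by_two_6.
- exact: drops_by_two_7.
- by rewrite !addnS; apply: drops_by_two_add2 => //; apply: IHk.
Qed.
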